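(* Let $p/q$ be an even rational parameter. Then every unit square of the integer grid has either exactly $0$ or exactly $2$ good edges.
   Context: An even rational parameter is a rational number $p/q\in(0,1)$, with $p,q$ positive integers in lowest terms, such that $pq$ is even. Put $\omega=p+q$ (an odd integer), $P=2p/\omega$, $Q=2q/\omega$ (so $P+Q=2$). Consider four families of lines in $\mathbb R^2$: $\mathcal H$, the horizontal lines $y=n$ ($n\in\mathbb Z$); $\mathcal V$, the vertical lines $x=n$ ($n\in\mathbb Z$); $\mathcal P$, the lines of slope $-P$ with integer $y$-intercept; $\mathcal Q$, the lines of slope $-Q$ with integer $y$-intercept. Define functions $\mathbb R^2\to\mathbb R/2\mathbb Z$ by $F_H(x,y)=2Py$, $F_V(x,y)=2Px$, $F_P(x,y)=Py+P^2x+1$, $F_Q(x,y)=Py+PQx+1$, each value being identified with its representative in $(-1,1]$. A unit segment is an edge $[n,n+1]\times\{m\}$ or $\{n\}\times[m,m+1]$ ($n,m\in\mathbb Z$) of a unit square of the integer grid; a horizontal unit segment lies on a line of $\mathcal H$ (set $A=H$), a vertical one on a line of $\mathcal V$ (set $A=V$). A point $z$ of a unit segment $s$ is a light point of $s$ if there is $B\in\{P,Q\}$ such that $z$ lies on a line of the family $\mathcal B$ and $F_A(z)F_B(z)>0$ and $|F_B(z)|<|F_A(z)|$. The light count of $s$ is the number of distinct light points of $s$, except that when $s$ is horizontal and a light point is the midpoint of $s$, that point is counted twice. A unit segment is good if its light count is exactly $1$. *)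

(* Defs.v *)
From HB Require Import structures.
From mathcomp Require Import all_boot all_order all_algebra.
From mathcomp Require Import boolp reals.
Set Implicit Arguments. Unset Strict Implicit. Unset Printing Implicit Defensive.
Import Order.TTheory GRing.Theory Num.Theory.
Local Open Scope ring_scope.

Section Defs.
Variable R : realType.
Variables p q : nat.

(* representative in (-1,1] of the class of x in R/2Z *)
Definition rep2 (x : R) : R := x - 2 * (Num.ceil ((x - 1) / 2))%:~R.

Definition omega : nat := (p + q)%N.
Definition PP : R := 2 * p%:R / omega%:R.
Definition QQ : R := 2 * q%:R / omega%:R.

Definition F_H (z : R * R) : R := rep2 (2 * PP * z.2).
Definition F_V (z : R * R) : R := rep2 (2 * PP * z.1).
Definition F_P (z : R * R) : R := rep2 (PP * z.2 + PP ^+ 2 * z.1 + 1).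
Definition F_Q (z : R * R) : R := rep2 (PP * z.2 + PP * QQ * z.1 + 1).

Definition on_lineP (z : R * R) : Prop := exists k : int, z.2 = - PP * z.1 + k%:~R.
Definition on_lineQ (z : R * R) : Prop := exists k : int, z.2 = - QQ * z.1 + k%:~R.

(* unit segments: Hseg n m = [n,n+1] x {m}, Vseg n m = {n} x [m,m+1] *)
Inductive useg := Hseg of int & int | Vseg of int & int.

Definition on_seg (s : useg) (z : R * R) : Prop :=
  match s with
  | Hseg n m => n%:~R <= z.1 <= n%:~R + 1 /\ z.2 = m%:~R
  | Vseg n m => z.1 = n%:~R /\ m%:~R <= z.2 <= m%:~R + 1
  end.

Definition is_horizontal (s : useg) : bool :=
  if s is Hseg _ _ then true else false.

Definition F_A (s : useg) : R * R -> R :=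
  match s with Hseg _ _ => F_H | Vseg _ _ => F_V end.

Definition midpoint (s : useg) : R * R :=
  match s with
  | Hseg n m => (n%:~R + 2^-1, m%:~R)
  | Vseg n m => (n%:~R, m%:~R + 2^-1)
  end.

Definition light_point (s : useg) (z : R * R) : Prop :=
  on_seg s z /\
  ( (on_lineP z /\ 0 < F_A s z * F_P z /\ `|F_P z| < `|F_A s z|)
  \/ (on_lineQ z /\ 0 < F_A s z * F_Q z /\ `|F_Q z| < `|F_A s z|)).

Definition light_count (s : useg) (c : nat) : Prop :=
  exists l : seq (R * R), uniq l /\ (forall z, z \in l <-> light_point s z) /\
    c = (size l + (is_horizontal s && (midpoint s \in l)))%N.

Definition good (s : useg) : Prop := light_count s 1.

Definition square_edges (n m : int) : seq useg :=
  [:: Hseg n m; Hseg n (m + 1); Vseg n m; Vseg (n + 1) m].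

Definition num_good_edges (n m : int) : nat :=
  count (fun s => `[< good s >]) (square_edges n m).

End Defs.

(* Main.v *)
(** Scale by [w = p + q], so that [P = 2p/w], and write [|x|] for the distance
    from the integer [x] to [2wZ].  The slanted lines have constant mass, which
    makes the light points of a grid line at height (or abscissa) [a] the points on
    slanted lines of intercept [a + e] for which the truth value of
    [|2pe| + |2pa| > w] differs from that of [2|2pa| > w].  Every unit segment
    meets exactly two relevant slanted lines, up to coincidences that do not
    affect goodness, so it is good iff [|2pe| + |2pa| > w] holds for exactly one
    of two values of [e], whose form depends only on [d] and [f], where
    [(p - q) n = w d - f] and [0 <= f < w].

    The condition [|x| + |y| > w] says [cos (pi x/w) + cos (pi y/w) < 0].  By the
    sum-to-product formula it is the exclusive or of [cos (pi (x + y)/2w) < 0] and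
    [cos (pi (x - y)/2w) < 0], so the goodness of the four edges of a square is the
    exclusive or of sixteen such terms, which cancel in pairs: the number of good
    edges is even.  Regrouping the terms by the same formula, four good
    edges would require an arc of the circle [R/2wZ] to separate two interleaved
    pairs of points if [f < 2p], and are excluded by a similar comparison of distances
    if [f >= 2p]. *)

Require Import Defs.
From HB Require Import structures.
From mathcomp Require Import all_boot all_order all_algebra.
From mathcomp Require Import boolp reals.
From mathcomp Require Import zify ring lra.
Set Implicit Arguments. Unset Strict Implicit. Unset Printing Implicit Defensive.
Import Order.TTheory GRing.Theory Num.Theory.
Local Open Scope ring_scope.

(** * Distances and arcs on the circle of length [2w] *)

Section Circle.
Variable w : int.
Hypothesis w_gt0 : 0 < w.

Definition cdist (x : int) : int := `|((x + w) %% (2 * w))%Z - w|.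

Lemma cdistP x : exists2 j : int, -w <= x - 2 * w * j < w & cdist x = `|x - 2 * w * j|.
Proof.
have w2 : 2 * w != 0 by lia.
exists ((x + w) %/ (2 * w))%Z; rewrite /cdist.
  have := divz_eq (x + w) (2 * w); have := modz_ge0 (x + w) w2.
  have := ltz_pmod (x + w) (_ : 0 < 2 * w); lia.
by congr `|_|; have := divz_eq (x + w) (2 * w); lia.
Qed.

Lemma cdistDz x j : cdist (x + 2 * w * j) = cdist x.
Proof.
have e : x + 2 * w * j + w = j * (2 * w) + (x + w) by ring.
by rewrite /cdist e modzMDl.
Qed.

Lemma cdist_small x : - (3 * w) <= x <= 3 * w ->
  cdist x = if `|x| <= w then `|x| else `|2 * w - `|x| |.
Proof.
move=> hx; have [j hj ->] := cdistP x.
have : [|| j == -1, j == 0, j == 1 | j == 2] by nia.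
by case/or4P => /eqP ej; subst j; case: ifP; lia.
Qed.

Lemma cdistN x : cdist (- x) = cdist x.
Proof.
have [j hj ->] := cdistP x.
have -> : - x = - (x - 2 * w * j) + 2 * w * (- j) by ring.
by rewrite cdistDz cdist_small; [case: ifP; lia | lia].
Qed.

Lemma cdist_lew x : cdist x <= w.
Proof. by have [j hj ->] := cdistP x; lia. Qed.

(* [cos (pi x/w) + cos (pi y/w) < 0] *)
Definition far2 x y := w < cdist x + cdist y.

(* [cos (pi x/w) < 0] *)
Definition far x := w < 2 * cdist x.

Hypothesis w_odd : exists h, w = 2 * h + 1.

Lemma cdist_rep x : exists2 r, - w <= r < w & exists j, x = r + 2 * w * j.
Proof.
have [j hj _] := cdistP x; exists (x - 2 * w * j) => //.
by exists j; ring.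
Qed.

(** In units of [pi/w] this is cos(a + b) + cos(a - b) = 2 cos a cos b. As [w] is odd, no cosine on
    the right vanishes, so the product is negative iff exactly one factor is. *)
Lemma far2_far a b : far2 (a + b) (a - b) = far a (+) far b.
Proof.
have [r hr [i ->]] := cdist_rep a; have [s hs [j ->]] := cdist_rep b.
have [h wE] := w_odd.
rewrite /far2 /far !cdistDz.
have -> : r + 2 * w * i + (s + 2 * w * j) = r + s + 2 * w * (i + j) by ring.
have -> : r + 2 * w * i - (s + 2 * w * j) = r - s + 2 * w * (i - j) by ring.
rewrite !cdistDz !cdist_small; try by lia.
case: (boolP (`|r + s| <= w)); case: (boolP (`|r - s| <= w));
case: (boolP (`|r| <= w)); case: (boolP (`|s| <= w)); lia.
Qed.

Variable p : int.
Hypothesis p_gt0 : 0 < p.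
Hypothesis p_lt : 2 * p < w.

(** The points with [t < cdist] form an arc centred at [w], possibly empty or full. Since
    [|y - x| <= 2p], the pairs [x - p, x + p] and [y - p, y + p] interleave on the circle, so no arc
    contains one pair and misses the other. *)
Lemma interleaved x y t : `|y - x| <= 2 * p ->
  (t < cdist (x - p)) = (t < cdist (x + p)) ->
  (t < cdist (y - p)) = (t < cdist (y + p)) ->
  (t < cdist (x - p)) = (t < cdist (y - p)).
Proof.
have [r hr [i ->]] := cdist_rep x => hyx.
have -> : y - p = y - 2 * w * i - p + 2 * w * i by ring.
have -> : y + p = y - 2 * w * i + p + 2 * w * i by ring.
have -> : r + 2 * w * i - p = r - p + 2 * w * i by ring.
have -> : r + 2 * w * i + p = r + p + 2 * w * i by ring.
rewrite !cdistDz; set y' := y - 2 * w * i.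
have {hyx} : `|y' - r| <= 2 * p by rewrite /y'; lia.
move: y' => {}y hyx; rewrite !cdist_small; try lia.
case: (boolP (`|r - p| <= w)); case: (boolP (`|r + p| <= w));
case: (boolP (`|y - p| <= w)); case: (boolP (`|y + p| <= w)); lia.
Qed.

Lemma cdist_le x j : cdist x <= `|x + 2 * w * j|.
Proof.
have [i hi ->] := cdistP x.
have [->|ne] := eqVneq i (- j); first by rewrite mulrN opprK.
have : (i + j <= - 1) || (1 <= i + j) by lia.
by case/orP => h; nia.
Qed.

Lemma cdistDw x : cdist (x + w) = w - cdist x.
Proof.
have [r hr [i ->]] := cdist_rep x.
have -> : r + 2 * w * i + w = r + w + 2 * w * i by ring.
rewrite !cdistDz !cdist_small; try lia.
by case: (boolP (`|r| <= w)); case: (boolP (`|r + w| <= w)); lia.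
Qed.

(** The hypotheses force [y] to lie within [2p - cdist x] of the antipode [w]; a rotation by [g]
    then moves it at least [cdist x] away from [w]. *)
Lemma near2_gap x y g : 2 * p <= g <= 2 * w - 2 * p ->
  cdist x + cdist y < w ->
  w < cdist (x - 2 * p) + cdist y -> w < cdist (x + 2 * p) + cdist y ->
  cdist x + cdist (y + g) < w.
Proof.
have [r hr [i ->]] := cdist_rep x; have [s hs [j ->]] := cdist_rep y => hg.
have -> : r + 2 * w * i - 2 * p = r - 2 * p + 2 * w * i by ring.
have -> : r + 2 * w * i + 2 * p = r + 2 * p + 2 * w * i by ring.
have -> : s + 2 * w * j + g = s + g + 2 * w * j by ring.
rewrite !cdistDz [cdist r]cdist_small ?[cdist s]cdist_small; try lia.
rewrite !ifT; try lia.
have := cdist_le (r - 2 * p) 0; have := cdist_le (r + 2 * p) 0.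
have := cdist_le (s + g) 0; have := cdist_le (s + g) (- 1).
have := cdist_le (s + g) (- 2).
move=> h1 h2 h3 h4 h5 h6 h7 h8.
have : w - 2 * p + `|r| < `|s| by lia.
lia.
Qed.

Lemma cdist_parity x : exists k, cdist x = x + 2 * k.
Proof.
have [j _ ->] := cdistP x.
have [h|h] := leP 0 (x - 2 * w * j); first by exists (- w * j); lia.
by exists (w * j - x); lia.
Qed.

Lemma cdist_neq x y k : x + y = 2 * k -> cdist x + cdist y != w.
Proof.
have [i ->] := cdist_parity x; have [j ->] := cdist_parity y.
by have [h ->] := w_odd => *; lia.
Qed.

(** Shifting both points by [w] replaces each distance by its complement to [w], which reverses all
    the inequalities of [near2_gap]. *)
Lemma far2_gap x y k g : x + y = 2 * k -> 2 * p <= g <= 2 * w - 2 * p ->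
  w < cdist x + cdist y ->
  cdist (x - 2 * p) + cdist y < w -> cdist (x + 2 * p) + cdist y < w ->
  w < cdist x + cdist (y + g).
Proof.
move=> hk hg h1 h2 h3.
have := @near2_gap (x + w) (y + w) g hg.
have -> : x + w - 2 * p = x - 2 * p + w by ring.
have -> : x + w + 2 * p = x + 2 * p + w by ring.
have -> : y + w + g = y + g + w by ring.
rewrite !cdistDw; lia.
Qed.

Lemma crossed x y k f g : x + y = 2 * k ->
  2 * p <= f <= 2 * w - 2 * p -> 2 * p <= g <= 2 * w - 2 * p ->
  far2 (x - 2 * p) y = far2 (x + 2 * p) y ->
  far2 x y != far2 (x + 2 * p) y ->
  far2 x (y + f) = far2 x (y + g).
Proof.
move=> hk hf hg e1 ne.
have n1 : cdist x + cdist y != w by apply: (@cdist_neq _ _ k).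
have n2 : cdist (x - 2 * p) + cdist y != w by apply: (@cdist_neq _ _ (k - p)); lia.
have n3 : cdist (x + 2 * p) + cdist y != w by apply: (@cdist_neq _ _ (k + p)); lia.
case: (boolP (far2 x y)) e1 ne; rewrite /far2 => h.
  case: (boolP (w < cdist (x + 2 * p) + cdist y)) => // h' e _.
  have l2 : cdist (x - 2 * p) + cdist y < w by lia.
  have l3 : cdist (x + 2 * p) + cdist y < w by lia.
  by rewrite !(@far2_gap x y k).
case: (boolP (w < cdist (x + 2 * p) + cdist y)) => // h' e _.
have l1 : cdist x + cdist y < w by lia.
have l2 : w < cdist (x - 2 * p) + cdist y by rewrite e.
by rewrite !ltNge !ltW // near2_gap.
Qed.

(** * Counting good edges around a square *)

Definition chi a b := far2 (2 * p * a) (2 * p * b).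

Lemma chi_far a b : chi a b = far (p * (a + b)) (+) far (p * (a - b)).
Proof. by rewrite -far2_far /chi; congr far2; ring. Qed.

(* Here [d] is the ceiling of [(2p - w) n / w], and [f = w d - (2p - w) n]; the
   inequality [f < 2p] says that [d] is the same for [n + 1] as for [n]. *)
Definition goodV n m d := chi (m + d) n (+) chi (m + 1 - d) n.
Definition goodH n m d f :=
  if f < 2 * p then chi (n + d) m (+) chi (n + 1 - d) m
  else chi (n + 1 - d) m (+) chi (n + 2 - d) m.

Lemma farN x : far (- x) = far x.
Proof. by rewrite /far cdistN. Qed.

(** Each edge compares two values of [A], and the four edges form a 4-cycle on the arguments
    [2(m+n)+1], [2(m-n)-1], [2(m+n)+3], [2(m-n)+1]. The number of changes around a cycle is even,
    and four changes would contradict [interleaved]. *)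
Lemma square_even_small n m d f :
  (2 * p - w) * n = w * d - f -> 0 <= f < 2 * p ->
  (goodH n m d f + goodH n (m + 1) d f + goodV n m d + goodV (n + 1) m d)%N
    \in [:: 0; 2]%N.
Proof.
move=> hd hf.
pose A c := far2 (p * c) (p * (2 * d - 1)).
have AE c a b : a = c + d -> b = c + 1 - d -> A (2 * c + 1) = far (p * a) (+) far (p * b).
  by move=> -> ->; rewrite -far2_far /A; congr far2; ring.
have goodHE k : goodH n k d f = A (2 * (n + k) + 1) (+) A (2 * (k - n) - 1).
  rewrite /goodH ifT; last lia.
  have -> : 2 * (k - n) - 1 = 2 * (k - n - 1) + 1 by ring.
  rewrite (AE _ (n + d + k) (n + 1 - d + k)); try ring.
  rewrite (AE _ (- (n + 1 - d - k)) (- (n + d - k))); try ring.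
  by rewrite !chi_far !mulrN !farN; do 4!case: far.
have goodVE k : goodV k m d = A (2 * (m + k) + 1) (+) A (2 * (m - k) + 1).
  rewrite /goodV !chi_far.
  rewrite (AE _ (m + d + k) (m + 1 - d + k)); try ring.
  rewrite (AE _ (m + d - k) (m + 1 - d - k)); try ring.
  by do 4!case: far.
rewrite !goodHE !goodVE.
have -> : 2 * (n + m) + 1 = 2 * (m + n) + 1 by ring.
have -> : 2 * (n + (m + 1)) + 1 = 2 * (m + n) + 3 by ring.
have -> : 2 * (m + (n + 1)) + 1 = 2 * (m + n) + 3 by ring.
have -> : 2 * (m + 1 - n) - 1 = 2 * (m - n) + 1 by ring.
have -> : 2 * (m - (n + 1)) + 1 = 2 * (m - n) - 1 by ring.
have tE c : A c = (w - cdist (p * (2 * d - 1)) < cdist (p * c)).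
  by rewrite /A /far2 ltrBlDr.
(* These are the centres of the two pairs. The multiple of [2w] makes their difference [2f - 2p], of
   absolute value at most [2p]. *)
have := @interleaved (p * (2 * (m + n) + 2) - 2 * w * (n + d)) (p * (2 * (m - n)))
  (w - cdist (p * (2 * d - 1))).
set x := p * (2 * (m + n) + 2) - _.
have -> : x - p = p * (2 * (m + n) + 1) + 2 * w * (- (n + d)) by rewrite /x; ring.
have -> : x + p = p * (2 * (m + n) + 3) + 2 * w * (- (n + d)) by rewrite /x; ring.
rewrite !cdistDz.
have -> : p * (2 * (m - n)) - p = p * (2 * (m - n) - 1) by ring.
have -> : p * (2 * (m - n)) + p = p * (2 * (m - n) + 1) by ring.
rewrite -!tE.
have -> : `|p * (2 * (m - n)) - x| <= 2 * p by rewrite /x; lia.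
by case: (A (2 * (m + n) + 1)); case: (A (2 * (m + n) + 3)); case: (A (2 * (m - n) - 1));
  case: (A (2 * (m - n) + 1)) => //; move/(_ isT erefl erefl).
Qed.

(** The horizontal edges compare [far2 x y] with [far2 (x - 2p) y] and [far2 (x + 2p) y]; the
    vertical ones compare [far2 x (y + 2f - 2p)] with [far2 x (y - 2p)] and [far2 x (y + 2p)]. By
    [crossed], two good horizontal edges leave no good vertical edge. *)
Lemma square_even_large n m d f :
  (2 * p - w) * n = w * d - f -> 2 * p <= f < w ->
  (goodH n m d f + goodH n (m + 1) d f + goodV n m d + goodV (n + 1) m (d - 1))%N
    \in [:: 0; 2]%N.
Proof.
move=> hd hf.
have r1 : 2 * p <= 2 * p <= 2 * w - 2 * p by lia.
have r2 : 2 * p <= 2 * f - 2 * p <= 2 * w - 2 * p by lia.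
have r3 : 2 * p <= 2 * w - 2 * p <= 2 * w - 2 * p by lia.
pose x := p * (2 * m + 1); pose y := p * (2 * n + 3 - 2 * d).
pose u1 := far (p * (m + n + 1 - d)); pose u2 := far (p * (m + n + 2 - d)).
pose u3 := far (p * (m + n + 3 - d)).
pose v1 := far (p * (m - n - 2 + d)); pose v2 := far (p * (m - n - 1 + d)).
pose v3 := far (p * (m - n + d)).
have x1 : far2 (x - 2 * p) y = u1 (+) v1.
  by rewrite -far2_far /x /y; congr far2; ring.
have x2 : far2 x y = u2 (+) v2.
  by rewrite -far2_far /x /y; congr far2; ring.
have x3 : far2 (x + 2 * p) y = u3 (+) v3.
  by rewrite -far2_far /x /y; congr far2; ring.
have y1 : far2 x (y - 2 * p) = u1 (+) v3.
  by rewrite -far2_far /x /y; congr far2; ring.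
have y2 : far2 x (y + 2 * p) = u3 (+) v1.
  by rewrite -far2_far /x /y; congr far2; ring.
have y3 : far2 x (y + (2 * f - 2 * p)) = far (p * (m + n + d)) (+) far (p * (m - n + 1 - d)).
  have fE : f = w * d - (2 * p - w) * n by rewrite hd; ring.
  rewrite -far2_far /x /y /far2.
  have -> : p * (2 * n + 3 - 2 * d) + (2 * f - 2 * p)
            = - (p * (2 * n - 1 + 2 * d)) + 2 * w * (n + d) by rewrite fE; ring.
  by rewrite cdistDz cdistN; congr (_ < cdist _ + cdist _); ring.
have ym : far2 x (y - 2 * p) = far2 x (y + (2 * w - 2 * p)).
  rewrite /far2; have -> : y + (2 * w - 2 * p) = y - 2 * p + 2 * w * 1 by ring.
  by rewrite cdistDz.
have xy : x + y = 2 * (p * (m + n + 2 - d)) by rewrite /x /y; ring.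
have := crossed xy r3 r2; have := crossed xy r1 r2.
rewrite -ym x1 x2 x3 y1 y2 y3.
have hH k : goodH n k d f = far (p * (n + 1 - d + k)) (+) far (p * (k - n - 1 + d))
   (+) (far (p * (n + 2 - d + k)) (+) far (p * (k - n - 2 + d))).
  rewrite /goodH ltNge (proj1 (andP hf)) /= !chi_far.
  have -> : p * (n + 1 - d - k) = - (p * (k - n - 1 + d)) by ring.
  have -> : p * (n + 2 - d - k) = - (p * (k - n - 2 + d)) by ring.
  by rewrite !farN.
rewrite !hH /goodV !chi_far.
have e1 : n + 1 - d + m = m + n + 1 - d by ring.
have e2 : n + 2 - d + m = m + n + 2 - d by ring.
have e3 : n + 1 - d + (m + 1) = m + n + 2 - d by ring.
have e4 : n + 2 - d + (m + 1) = m + n + 3 - d by ring.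
have e5 : m + 1 - n - 1 + d = m - n + d by ring.
have e6 : m + 1 - n - 2 + d = m - n - 1 + d by ring.
have e7 : m + d + n = m + n + d by ring.
have e8 : m + d - n = m - n + d by ring.
have e9 : m + 1 - d + n = m + n + 1 - d by ring.
have e10 : m + 1 - d - n = m - n + 1 - d by ring.
have e11 : m + (d - 1) + (n + 1) = m + n + d by ring.
have e12 : m + (d - 1) - (n + 1) = m - n - 2 + d by ring.
have e13 : m + 1 - (d - 1) + (n + 1) = m + n + 3 - d by ring.
have e14 : m + 1 - (d - 1) - (n + 1) = m - n + 1 - d by ring.
rewrite e1 e2 e3 e4 e5 e6 e7 e8 e9 e10 e11 e12 e13 e14.
rewrite -/u1 -/u2 -/u3 -/v1 -/v2 -/v3.
move: u1 u2 u3 v1 v2 v3 (far _) (far _) {x1 x2 x3 y1 y2 y3}.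
by do 8!case; move=> //= c1 c2; move: (c1 erefl isT) (c2 erefl isT).
Qed.
End Circle.

(** * From light points to lit slanted lines *)

Section Light.
Variables (R : realType) (p q : nat).
Hypotheses (p_gt0 : (0 < p)%N) (p_ltq : (p < q)%N).
Hypotheses (pq_coprime : coprime p q) (pq_even : ~~ odd (p * q)).
Variable w : int.
Hypothesis wpq : w = (p + q)%N.

Lemma omega_odd : exists h : int, w = 2 * h + 1.
Proof.
have : odd (p + q).
  have : ~~ (~~ odd p && ~~ odd q).
    apply/negP => /andP[hp hq]; move: pq_coprime; rewrite /coprime => /eqP g1.
    have : (2 %| gcdn p q)%N by rewrite dvdn_gcd !dvdn2 hp hq.
    by rewrite g1.
  by move: pq_even; rewrite oddM oddD; case: odd; case: odd.
move=> h; exists ((p + q)./2 : int); rewrite wpq.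
by have := odd_double_half (p + q); rewrite h; lia.
Qed.

(* The doubled midpoint in the light count makes the number of light points on
   [s] the number of true booleans even when the two candidates coincide. *)
Lemma good_two s (z1 z2 : R * R) (b1 b2 : bool) :
  (forall z, light_point p q s z <-> z = z1 /\ b1 \/ z = z2 /\ b2) ->
  (z1 = z2 -> b1 = b2 /\ is_horizontal s && (z1 == midpoint R s)) ->
  (is_horizontal s -> z1 = midpoint R s \/ z2 = midpoint R s -> z1 = z2) ->
  good R p q s <-> b1 (+) b2.
Proof.
move=> lightE eq12 mid12; split.
  move=> [[|z0 [|z0' l]] [ul [hl]]]; rewrite ?in_nil ?andbF ?addSn //.
  move=> [] /esym/eqP; rewrite add0n eqb0 => nm.
  have lz0 z : light_point p q s z <-> z = z0.
    by rewrite -hl inE; split => /eqP.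
  case: b1 b2 lightE eq12 => -[] lightE eq12 //.
    have e1 : z1 = z0 by apply/lz0/lightE; left.
    have e2 : z2 = z0 by apply/lz0/lightE; right.
    have [_ /andP[sh /eqP zm]] := eq12 (etrans e1 (esym e2)).
    by move: nm; rewrite sh -zm e1 inE eqxx.
  by have /lightE[[]|[]] := (lz0 z0).2 erefl.
move=> xb.
have ne : z1 <> z2 by move=> /eq12[eb _]; move: xb; rewrite eb addbb.
have nm z : z = z1 \/ z = z2 -> is_horizontal s && (midpoint R s \in [:: z]) = false.
  move=> hz; apply/negP => /andP[sh]; rewrite inE => /eqP ez; apply: ne; apply: mid12 => //.
  by case: hz => <-; [left|right].
case: b1 b2 lightE xb {eq12} => -[] // lightE _.
  exists [:: z1]; rewrite nm; last by left.
  split=> //; split => // z; rewrite inE lightE.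
  by split => [/eqP ->|[[-> _]|[]]] //; left.
exists [:: z2]; rewrite nm; last by right.
split=> //; split => // z; rewrite inE lightE.
by split => [/eqP ->|[[]|[-> _]]] //; right.
Qed.

Lemma rep2E (x y : R) (j : int) : x = y + 2 * j%:~R -> -1 < y <= 1 -> rep2 x = y.
Proof.
move=> -> /andP[y1 y2]; rewrite /rep2.
suff -> : Num.ceil ((y + 2 * j%:~R - 1) / 2) = j by ring.
by apply: ceil_def; rewrite rmorphB /=; lra.
Qed.

Lemma w_gt0 : 0 < w. Proof. rewrite wpq; lia. Qed.
Lemma p2_ltw : 2 * p%:Z < w. Proof. rewrite wpq; lia. Qed.

Lemma wR_gt0 : 0 < w%:~R :> R. Proof. by rewrite ltr0z w_gt0. Qed.

Lemma PPE : PP R p q = (2 * p%:Z)%:~R / w%:~R.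
Proof. by rewrite /PP /omega wpq intrM !pmulrn. Qed.

Lemma QQE : QQ R p q = (2 * q%:Z)%:~R / w%:~R.
Proof. by rewrite /QQ /omega wpq intrM !pmulrn. Qed.

Lemma rep2_div x : exists2 r : int, - w < r <= w &
  (exists j, x = r + 2 * w * j) /\ rep2 (x%:~R / w%:~R) = r%:~R / w%:~R :> R.
Proof.
(* [cdist_rep] yields the interval [[-w, w)]; negation turns it into the [(-w, w]] of [rep2]. *)
have [r hr [j e]] := cdist_rep w_gt0 (- x).
exists (- r); first by lia.
split; first by exists (- j); rewrite -[x]opprK e; ring.
apply: (rep2E (j := - j)).
  rewrite -[x]opprK e !(rmorphN, rmorphD, rmorphM) /=.
  by field; rewrite lt0r_neq0 // wR_gt0.
rewrite ltr_pdivlMr ?ler_pdivrMr ?wR_gt0 // mulN1r mul1r -mulrNz ltr_int ler_int; lia.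
Qed.

Lemma mulr_gt0_sign (r s : int) : (0 < r * s) = (0 < r) && (0 < s) || (r < 0) && (s < 0).
Proof.
have [h|h|->] := ltrgtP r 0; last by rewrite mul0r.
  by rewrite nmulr_rgt0.
by rewrite pmulr_rgt0 ?orbF.
Qed.

Lemma abs_lt2 i : `|2 * w * i| < 4 * w -> [|| i == -1, i == 0 | i == 1].
Proof. by have := w_gt0; nia. Qed.

(* The line of intercept [m + e] is lit on the grid line of index [m]. *)
Definition lit (m e : int) := chi w p e m (+) far w (2 * p%:Z * m).

(** The left side says that [F'] lies strictly between 0 and [F], that is, closer than [|F|/2] to
    their midpoint. Scaled by [w], with [g = 2pm] and [u = 2p(k-m)] reduced modulo [2w], the
    midpoint is [g] if [2|g| < w] and [g] shifted by [w] otherwise; the condition is [|u| + |g| > w]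
    in the first case and its negation in the second. *)
Lemma litE (m k : int) (F F' : R) :
  F = rep2 (2 * PP R p q * m%:~R) -> F' = rep2 (PP R p q * k%:~R + 1) ->
  (0 < F * F' /\ `|F'| < `|F|) <-> lit m (k - m).
Proof.
move=> -> ->.
have w0 : w%:~R != 0 :> R by rewrite lt0r_neq0 // wR_gt0.
have -> : 2 * PP R p q * m%:~R = (4 * p%:Z * m)%:~R / w%:~R.
  by rewrite PPE !intrM; field.
have -> : PP R p q * k%:~R + 1 = (2 * p%:Z * k + w)%:~R / w%:~R.
  by rewrite PPE rmorphD /= !intrM; field.
have [r hr [[i re] ->]] := rep2_div (4 * p%:Z * m).
have [s hs [[j se] ->]] := rep2_div (2 * p%:Z * k + w).
have -> : (0 < r%:~R / w%:~R * (s%:~R / w%:~R) :> R) = (0 < r * s).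
  by rewrite mulrACA pmulr_lgt0 -?intrM ?ltr0z // -invfM invr_gt0 mulr_gt0 // wR_gt0.
have -> : (`|s%:~R / w%:~R| < `|r%:~R / w%:~R| :> R) = (`|s| < `|r|).
  rewrite !normrM ltr_pM2r; last by rewrite normr_gt0 invr_neq0.
  by rewrite -!intr_norm ltr_int.
rewrite /lit /chi /far2 /far.
have [g hg [a ge]] := cdist_rep w_gt0 (2 * p%:Z * m).
have [u hu [b ue]] := cdist_rep w_gt0 (2 * p%:Z * (k - m)).
rewrite ge ue !cdistDz !(cdist_small w_gt0); try lia.
have [h wE] := omega_odd.
have {re} er : r = 2 * g + 2 * w * (2 * a - i) by lia.
have {se} es : s = g + u + w + 2 * w * (a + b - j) by lia.
(* Both [g] and [u] are even and [w] is odd, so [|u| + |g| = w] cannot occur. *)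
have eg : g = 2 * (p%:Z * m - w * a) by lia.
have eu : u = 2 * (p%:Z * (k - m) - w * b) by lia.
move: (p%:Z * m - w * a) (p%:Z * (k - m) - w * b) eg eu er es => g' u' eg eu.
move: (2 * a - i) (a + b - j) {ge ue} => {}i {}j er es.
rewrite mulr_gt0_sign.
have hi : [|| i == -1, i == 0 | i == 1] by apply: abs_lt2; lia.
have hj : [|| j == -1, j == 0 | j == 1] by apply: abs_lt2; lia.
have -> : `|g| <= w by lia.
have -> : `|u| <= w by lia.
apply: (@iff_trans _ (((0 < r) && (0 < s) || (r < 0) && (s < 0)) && (`|s| < `|r|))).
  by split=> [[-> ->]|/andP].
suff -> : ((0 < r) && (0 < s) || (r < 0) && (s < 0)) && (`|s| < `|r|)
  = (w < `|u| + `|g|) (+) (w < 2 * `|g|) by [].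
by case/or3P: hi er => /eqP->; case/or3P: hj es => /eqP-> *; lia.
Qed.
Definition seg_line (s : useg) : int := match s with Hseg _ m => m | Vseg n _ => n end.

Lemma light_pointE s (z : R * R) : light_point p q s z <->
  on_seg s z /\ exists c k : int, [/\ c = p \/ c = q,
    z.2 = - ((2 * c)%:~R / w%:~R) * z.1 + k%:~R & lit (seg_line s) (k - seg_line s)].
Proof.
have FAE : on_seg s z -> F_A p q s z = rep2 (2 * PP R p q * (seg_line s)%:~R).
  by case: s => a b /= [] => [_ <-|<- _].
have FPE k : z.2 = - PP R p q * z.1 + k%:~R -> F_P p q z = rep2 (PP R p q * k%:~R + 1).
  by move=> e; rewrite /F_P e; congr rep2; ring.
have FQE k : z.2 = - QQ R p q * z.1 + k%:~R -> F_Q p q z = rep2 (PP R p q * k%:~R + 1).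
  by move=> e; rewrite /F_Q e; congr rep2; ring.
split=> -[zs].
  move=> h; split=> //; case: h => -[[k zk] /(litE (FAE zs)) h].
    by exists p, k; rewrite -PPE; split; [left| |apply/h/FPE].
  by exists q, k; rewrite -QQE; split; [right| |apply/h/FQE].
move=> [c [k [[]-> zk l]]]; split=> //; [left|right].
  rewrite -PPE in zk; split; first by exists k.
  by apply/(litE (FAE zs) (FPE _ zk)).
rewrite -QQE in zk; split; first by exists k.
by apply/(litE (FAE zs) (FQE _ zk)).
Qed.

Lemma light_pointH n m (z : R * R) : light_point p q (Hseg n m) z <->
  exists c e : int, [/\ c = p \/ c = q, 2 * c * n <= w * e <= 2 * c * (n + 1),
    z = ((w * e)%:~R / (2 * c)%:~R, m%:~R) & lit m e].
Proof.
rewrite light_pointE /=; have w0 := wR_gt0; have wn := lt0r_neq0 w0.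
have n1 : (n + 1)%:~R = n%:~R + 1 :> R by rewrite rmorphD.
split.
  move=> [[zn zm] [c [k [hc zl l]]]]; exists c, (k - m).
  have c0 : 0 < c by case: hc => ->; lia.
  have c2 : 0 < (2 * c)%:~R :> R by rewrite ltr0z; lia.
  have e1 : z.1 = (w * (k - m))%:~R / (2 * c)%:~R.
    apply: (mulIf (lt0r_neq0 c2)); rewrite divfK ?lt0r_neq0 //.
    rewrite [(w * _)%:~R]intrM rmorphB /= -zm zl.
    by field.
  split=> //; last by rewrite -zm -e1; case: (z).
  by move: zn; rewrite e1 ler_pdivlMr // ler_pdivrMr // -n1 -!intrM !ler_int
    ![_ * (2 * c)]mulrC.
move=> [c [e [hc he -> l]]] /=.
have c0 : 0 < c by case: hc => ->; lia.
have c2 : 0 < (2 * c)%:~R :> R by rewrite ltr0z; lia.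
split.
  by split=> //; rewrite ler_pdivlMr // ler_pdivrMr // -n1 -!intrM !ler_int
    ![_ * (2 * c)]mulrC.
exists c, (e + m); split=> //; last by rewrite addrK.
rewrite !intrM rmorphD /=; field.
by rewrite wn intr_eq0 lt0r_neq0.
Qed.

Lemma light_pointV n m (z : R * R) : light_point p q (Vseg n m) z <->
  exists c e : int, [/\ c = p \/ c = q, w * m <= w * (e + n) - 2 * c * n <= w * (m + 1),
    z = (n%:~R, (w * (e + n) - 2 * c * n)%:~R / w%:~R) & lit n e].
Proof.
rewrite light_pointE /=; have w0 := wR_gt0; have wn := lt0r_neq0 w0.
have m1 : (m + 1)%:~R = m%:~R + 1 :> R by rewrite rmorphD.
have e1 (c k : int) : - ((2 * c)%:~R / w%:~R) * n%:~R + k%:~R =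
    (w * k - 2 * c * n)%:~R / w%:~R :> R.
  by rewrite rmorphB /= !intrM; field.
split.
  move=> [[zn zm] [c [k [hc zl l]]]]; exists c, (k - n).
  move: zl zm; rewrite zn e1 subrK => zl.
  rewrite zl ler_pdivlMr // ler_pdivrMr // -m1 -!intrM !ler_int ![_ * w]mulrC => zm.
  by split=> //; rewrite -zn -zl; case: (z).
move=> [c [e [hc he -> l]]] /=; split.
  by split=> //; rewrite ler_pdivlMr // ler_pdivrMr // -m1 -!intrM !ler_int ![_ * w]mulrC.
by exists c, (e + n); rewrite e1 addrK.
Qed.

(** * The two relevant slanted lines of a unit segment *)

Lemma pqE : 2 * q%:Z = 2 * w - 2 * p%:Z. Proof. by rewrite wpq; lia. Qed.

Lemma mulw_small k : - w < w * k < w -> k = 0.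
Proof. by have := w_gt0; nia. Qed.

(** This matches the truth values of a line of slope [-P] and one of slope [-Q] that cross a
    horizontal line at the same point. *)
Lemma lit_opp m e j : lit m (w * j - e) = lit m e.
Proof.
rewrite /lit /chi /far2.
have -> : 2 * p%:Z * (w * j - e) = - (2 * p%:Z * e) + 2 * w * (p%:Z * j) by ring.
by rewrite cdistDz (cdistN w_gt0).
Qed.

Lemma lit_xor m e1 e2 : lit m e1 (+) lit m e2 = chi w p e1 m (+) chi w p e2 m.
Proof. by rewrite /lit; case: far; case: chi; case: chi. Qed.

Lemma lit_aligned n k e : 2 * p%:Z * n = w * k -> lit n e = false.
Proof.
move=> h; rewrite /lit /chi /far2 /far h.
have [h' wE] := omega_odd.
have -> : w * k = 0 + 2 * w * (p%:Z * n - h' * k).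
  have -> : 2 * w * (p%:Z * n - h' * k) = w * (2 * p%:Z * n) - 2 * h' * (w * k) by ring.
  have -> : 2 * h' = w - 1 by rewrite wE addrK.
  by rewrite h; ring.
rewrite cdistDz (_ : cdist w 0 = 0).
  by have := cdist_lew w_gt0 (2 * p%:Z * e); have := w_gt0; lia.
by rewrite /cdist add0r modz_small ?subrr //; have := w_gt0; lia.
Qed.

Lemma dvdw_mul a n j : coprime a (p + q) -> a%:Z * n = w * j -> exists k, n = w * k.
Proof.
move=> co h; have : (w %| n)%Z.
  rewrite -(@Gauss_dvdzr w a%:Z) ?h ?dvdz_mulr //.
  by rewrite wpq coprimezE /= coprime_sym.
by case/dvdzP => k ->; exists k; rewrite mulrC.
Qed.

(** The crossings on the segment are at heights [f/w] and [1 - f/w] above [m], distinct because [w]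
    is odd. For [f = 0] they sit at the endpoints, where [lit_aligned] shows that nothing is lit. *)
Lemma goodV_iff n m d f : (2 * p%:Z - w) * n = w * d - f -> 0 <= f < w ->
  good R p q (Vseg n m) <-> goodV w p n m d.
Proof.
move=> hd hf.
have wR0 : w%:~R != 0 :> R by rewrite intr_eq0; lia.
have fp e : w * (e + n) - 2 * p%:Z * n = w * (e - d) + f by lia.
have fq e : w * (e + n) - 2 * q%:Z * n = w * (e + d) - f by rewrite pqE; lia.
rewrite /goodV -lit_xor.
apply: (@good_two _
  (n%:~R, (w * (m + d + n) - 2 * p%:Z * n)%:~R / w%:~R)
  (n%:~R, (w * (m + 1 - d + n) - 2 * q%:Z * n)%:~R / w%:~R)) => //.
- move=> z; rewrite light_pointV; split.
    move=> [c [e [hc he zE l]]].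
    have f0 : 0 < f.
      rewrite lt_neqAle (proj1 (andP hf)) andbT; apply/eqP => f0.
      by move: l; rewrite (@lit_aligned n (n + d)) //; lia.
    case: hc he zE => -> he zE; [left|right].
      suff eE : e = m + d by rewrite zE eE -eE.
      by move: he; rewrite fp => he; have := @mulw_small (e - d - m); lia.
    suff eE : e = m + 1 - d by rewrite zE eE -eE.
    by move: he; rewrite fq => he; have := @mulw_small (e + d - m - 1); lia.
  move=> [] [-> l]; [exists p, (m + d) | exists q, (m + 1 - d)]; split=> //.
  + by left.
  + by rewrite fp; lia.
  + by right.
  by rewrite fq; lia.
case=> /(mulIf (invr_neq0 wR0)) /intr_inj; rewrite fp fq.
by have [h wE] := omega_odd; lia.
Qed.
Lemma coprime_omega : coprime p (p + q) /\ coprime q (p + q).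
Proof. by rewrite /coprime gcdnDl gcdnDr [gcdn q p]gcdnC; split. Qed.

Lemma ratio_eq (c c' e e' : int) : 0 < c -> 0 < c' ->
  ((w * e)%:~R / (2 * c)%:~R = (w * e')%:~R / (2 * c')%:~R :> R) <-> e * c' = e' * c.
Proof.
move=> c0 c0'; have := wR_gt0 => w0.
have h0 : (2 * c)%:~R != 0 :> R by rewrite intr_eq0; lia.
have h0' : (2 * c')%:~R != 0 :> R by rewrite intr_eq0; lia.
split=> [/eqP|h]; last first.
  apply/eqP; rewrite eqr_div // -!intrM eqr_int; apply/eqP.
  by have := congr1 ( *%R (2 * w)) h; lia.
rewrite eqr_div // -!intrM eqr_int => /eqP h.
by apply: (@mulfI _ (2 * w)); [have := w_gt0; lia | lia].
Qed.

Lemma ratio_mid (c e n : int) : 0 < c ->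
  ((w * e)%:~R / (2 * c)%:~R = n%:~R + 2^-1 :> R) -> w * e = c * (2 * n + 1).
Proof.
move=> c0 h; apply: (@intr_inj R).
have h0 : (2 * c)%:~R != 0 :> R by rewrite intr_eq0; lia.
by rewrite -[LHS](divfK h0) h; field.
Qed.

Lemma dvdw_mul2 (a : nat) n k : coprime a (p + q) -> 2 * a%:Z * n = w * k ->
  exists j, n = w * j.
Proof.
move=> co h; have [h' wE] := omega_odd.
have ek : k = 2 * (a%:Z * n - h' * k) by move: h; rewrite {1}wE; lia.
by apply: (@dvdw_mul a n (a%:Z * n - h' * k) co); move: h; rewrite {1}ek; lia.
Qed.

(** One line of slope [-Q] always meets the segment; the second candidate has slope [-P] if [f < 2p]
    and slope [-Q] otherwise. A further line arises only at an endpoint, for [f = 0] or [f = 2p],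
    and there it meets the second candidate with the same truth value. *)
Lemma goodH_iff n m d f : (2 * p%:Z - w) * n = w * d - f -> 0 <= f < w ->
  good R p q (Hseg n m) <-> goodH w p n m d f.
Proof.
move=> hd hf; have [cop coq] := coprime_omega; have w0 := w_gt0.
have qE : q%:Z = w - p%:Z by rewrite wpq; lia.
have p0 : 0 < p%:Z by lia.
have q0 : 0 < q%:Z by lia.
have pw := p2_ltw.
have np : 2 * p%:Z * n = w * (n + d) - f by lia.
have nq : 2 * q%:Z * n = w * (n - d) + f by rewrite pqE; lia.
pose c2 := if f < 2 * p%:Z then p%:Z else q%:Z.
pose e2 := if f < 2 * p%:Z then n + d else n + 2 - d.
have c20 : 0 < c2 by rewrite /c2; case: ifP.
have -> : goodH w p n m d f = lit m (n + 1 - d) (+) lit m e2.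
  by rewrite lit_xor /goodH /e2; case: ifP => // _; rewrite addbC.
have z12 : (w * (n + 1 - d))%:~R / (2 * q%:Z)%:~R = (w * e2)%:~R / (2 * c2)%:~R :> R <->
    f < 2 * p%:Z /\ w * (n + d) = p%:Z * (2 * n + 1).
  rewrite ratio_eq // /c2 /e2; case: ifP => hfp; last first.
    by split=> [/(mulIf (lt0r_neq0 q0))|[]] //; lia.
  by rewrite qE; split=> [|[_]] h; [split=> //|]; lia.
apply: (@good_two _
  ((w * (n + 1 - d))%:~R / (2 * q%:Z)%:~R, m%:~R) ((w * e2)%:~R / (2 * c2)%:~R, m%:~R)).
- move=> z; rewrite light_pointH; split.
  + move=> [c [e [hc he zE l]]]; case: hc he zE => -> he zE.
      have ee : e = n + d by have := @mulw_small (e - (n + d)); lia.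
      right; rewrite /e2 /c2; case: ifP => hfp; first by rewrite zE -ee.
      have fE : f = 2 * p%:Z by move: he; rewrite ee; lia.
      have [k kE] : exists k, n + 1 = w * k by apply: (@dvdw_mul2 p _ (n + d)) => //; lia.
      have -> : n + 2 - d = w * (2 * k) - e by rewrite ee; lia.
      rewrite lit_opp zE; split=> //; congr (_, _); apply/ratio_eq => //.
      by rewrite qE ee; lia.
    have : [|| e == n - d, e == n + 1 - d | e == n + 2 - d].
      have := @mulw_small (e - (n + 1 - d)).
      by nia.
    case/or3P => /eqP ee; last 2 first.
    * by left; rewrite zE -ee.
    * have hfp : (f < 2 * p%:Z) = false by move: he; rewrite ee; lia.
      by right; rewrite /c2 /e2 hfp zE -ee.
    have f0 : f = 0 by move: he; rewrite ee; lia.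
    have hfp : f < 2 * p%:Z by lia.
    have [k kE] : exists k, n = w * k by apply: (@dvdw_mul2 p _ (n + d)) => //; lia.
    right; rewrite /c2 /e2 hfp.
    have -> : n + d = w * (2 * k) - e by rewrite ee; lia.
    rewrite lit_opp zE; split=> //; congr (_, _); apply/ratio_eq => //.
    by rewrite qE ee; lia.
  + move=> [] [-> l]; last first.
      exists c2, e2; split=> //; rewrite /c2 /e2; first by case: ifP; [left|right].
      by case: ifP => hfp; lia.
    by exists q, (n + 1 - d); split=> //; [right|lia].
- case=> /z12[hfp h].
  have h' : w * (n + 1 - d) = q%:Z * (2 * n + 1) by rewrite qE; lia.
  split.
    have [k kE] : exists k, 2 * n + 1 = w * k by apply: (@dvdw_mul p _ (n + d)).
    have -> : n + 1 - d = w * k - e2 by rewrite /e2 hfp; lia.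
    by rewrite lit_opp.
  rewrite /= xpair_eqE eqxx andbT h'.
  apply/eqP; rewrite !intrM rmorphD /= intrM; field.
  by rewrite pnatr_eq0; lia.
move=> _ h; suff [hfp h'] : f < 2 * p%:Z /\ w * (n + d) = p%:Z * (2 * n + 1).
  by congr (_, _); apply/z12.
case: h => -[/ratio_mid].
  by move/(_ q0); rewrite qE => h; have : f < 2 * p%:Z; [lia|split=> //; lia].
move/(_ c20); rewrite /c2 /e2; case: ifP => hfp // h.
have : 2 * (w * (n + 2 - d)) = 2 * (q%:Z * (2 * n + 1)) by rewrite h.
by rewrite qE; lia.
Qed.
End Light.

Theorem theorem2p1 (R : realType) (p q : nat) :
  (0 < p)%N -> (p < q)%N -> coprime p q -> ~~ odd (p * q) ->
  forall n m : int,
    num_good_edges R p q n m = 0%N \/ num_good_edges R p q n m = 2%N.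
Proof.
move=> p_gt0 p_ltq co ev n m.
pose w : int := (p + q)%N; have wpq : w = (p + q)%N by [].
have w0 : 0 < w by rewrite wpq; lia.
have p0 : 0 < p%:Z by lia.
have pw : 2 * p%:Z < w by rewrite wpq; lia.
have w_odd := omega_odd p_gt0 p_ltq co ev wpq.
clearbody w.
pose x := (w - 2 * p%:Z) * n; pose d := - (x %/ w)%Z; pose f := (x %% w)%Z.
have hd : (2 * p%:Z - w) * n = w * d - f.
  by have := divz_eq x w; rewrite /d /f /x; lia.
have hf : 0 <= f < w by rewrite modz_ge0 ?ltz_pmod ?lt0r_neq0.
have gH k : `[< good R p q (Hseg n k) >] = goodH w p n k d f.
  by apply/asboolP/idP => /(goodH_iff R p_gt0 p_ltq co ev wpq k hd hf).
have gV k l d' f' : (2 * p%:Z - w) * k = w * d' - f' -> 0 <= f' < w ->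
    `[< good R p q (Vseg k l) >] = goodV w p k l d'.
  by move=> h h'; apply/asboolP/idP => /(goodV_iff R p_gt0 p_ltq co ev wpq l h h').
suff : num_good_edges R p q n m \in [:: 0; 2]%N.
  by rewrite !inE => /orP[] /eqP; [left|right].
rewrite /num_good_edges /= addn0 !gH (gV n m d f) //.
(* Passing from [n] to [n + 1] lowers [w d - f] by [w - 2p], so the remainder becomes [f + w - 2p]
   with the same [d], or [f - 2p] with [d - 1]. *)
have [fp|fp] := ltP f (2 * p%:Z).
  rewrite (gV (n + 1) m d (f + w - 2 * p%:Z)) ?addnA; [|lia..].
  by apply: square_even_small => //; lia.
rewrite (gV (n + 1) m (d - 1) (f - 2 * p%:Z)) ?addnA; [|lia..].
by apply: square_even_large => //; lia.
Qed.
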